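(* Let $G$ be either the complete graph $K_n$ or the star graph $S_n$, and run the dispersion process on $G$ with $M$ particles all initially placed at an origin vertex. Let $\delta>0$ be a constant. (i) If $M/n \le \frac12(1-\delta)$, then with probability $1-O(1/n)$ the dispersion process terminates in $\mathbf T_{\text{Disp}} = O(\log n)$ steps. (ii) If $\frac12(1+\delta)\le M/n<1$, then there is a constant $c=c(\delta)>0$ such that $\Pr(\mathbf T_{\text{Disp}}\le e^{cn}) < e^{-cn}$.
   Context: The dispersion process on a graph $G$: $M$ particles are initially placed at a distinguished origin vertex. The process is synchronous in discrete time steps. At each step, at each vertex $v$ occupied by more than one particle at the beginning of the step, each of these particles moves to a neighbour of $v$ chosen independently and uniformly at random; a particle alone at its vertex does not move. The process ends at the first step at which every vertex holds at most one particle; $\mathbf T_{\text{Disp}}$ denotes this number of steps (the dispersion time). The star graph $S_n$ consists of a central vertex adjacent to all other vertices, which are leaves. *)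

(* Defs.v *)
From HB Require Import structures.
From mathcomp Require Import all_boot all_order all_algebra.
From mathcomp Require Import all_classical all_reals all_analysis.

Set Implicit Arguments.
Unset Strict Implicit.
Unset Printing Implicit Defensive.
Import Order.TTheory GRing.Theory Num.Theory.

Local Open Scope classical_set_scope.
Local Open Scope ring_scope.

(* A graph is given by its adjacency relation. Both graphs below have the
   vertex set {0, ..., n-1}, so the star has n - 1 leaves. *)

Definition complete_graph (n : nat) : rel 'I_n := fun u v => u != v.

(* The centre is the vertex 0. *)
Definition star_graph (n : nat) : rel 'I_n := fun u v =>
  (u != v) && ((val u == 0%N) || (val v == 0%N)).

Section Dispersion.
Context {V : finType} {M : nat}.

(* Positions of the M (labelled) particles. *)
Definition config : Type := {ffun 'I_M -> V}.

Definition occupancy (x : config) (v : V) : nat := #|[pred i | x i == v]|.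

Definition dispersed (x : config) : Prop := forall v, (occupancy x v <= 1)%N.

Context {R : realType} (G : rel V).

Definition degree (v : V) : nat := #|[pred u | G v u]|.

(* Probability that, from configuration x, particle i is at v after one step. *)
Definition move_prob (x : config) (i : 'I_M) (v : V) : R :=
  if (1 < occupancy x (x i))%N then
    if G (x i) v then (degree (x i))%:R^-1 else 0
  else (v == x i)%:R.

(* The particles move independently given x, hence the product. *)
Definition step_prob (x y : config) : R := \prod_(i < M) move_prob x i (y i).

Context {d : measure_display} {Omega : measurableType d}.

(* The trajectory is not stopped at dispersion; this does not matter, since a
   dispersed configuration is left unchanged by step_prob. The last clause
   is the Markov property, conditional probabilities being multiplied out so
   that paths of probability 0 need no separate treatment. *)
Definition dispersion_process (P : probability Omega R) (o : V)
    (X : nat -> Omega -> config) : Prop :=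
  [/\ forall t x, measurable [set w | X t w = x],
      P [set w | X 0%N w = [ffun=> o]] = 1%E
    & forall (t : nat) (x : nat -> config),
        P [set w | forall s, (s <= t.+1)%N -> X s w = x s]
        = (P [set w | forall s, (s <= t)%N -> X s w = x s]
           * (step_prob (x t) (x t.+1))%:E)%E].

(* The infimum of the empty set is +oo: the process never disperses. *)
Definition dispersion_time (X : nat -> Omega -> config) (w : Omega) : \bar R :=
  ereal_inf [set t%:R%:E | t in [set t | dispersed (X t w)]].

End Dispersion.

Arguments config : clear implicits.
Arguments complete_graph : clear implicits.
Arguments star_graph : clear implicits.

(* Main.v *)
(* A particle is unhappy if it shares its vertex, and a configuration is
   dispersed when nobody is unhappy. On the star the unhappy particles alternate
   between the centre and the leaves, and the steps towards the centre change
   nothing; every other step, on either graph, sends each unhappy particle to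
   one of n - 1 vertices uniformly at random.
   (i) In such a step a moving particle collides with probability at most
   (M - 1) / (n - 1), and at most as many resting particles become unhappy as
   moving ones collide. So the mean number of unhappy particles is multiplied by
   at most 2 (M - 1) / (n - 1) <= 1 - delta, and Markov's inequality applies.
   (ii) Let m be about delta n / 16 and let at least m particles be unhappy.
   Reveal the moves of m of them last, one by one. While fewer than m particles
   collide, more than (1 / 2 + delta / 4) n vertices hold exactly one particle,
   and hitting one of them creates two unhappy particles. Hence fewer than m
   particles are unhappy after the step with probability exponentially small
   in m, and a union bound over exp (c n) steps concludes. *)
Require Import Defs.
From HB Require Import structures.
From mathcomp Require Import all_boot all_order all_algebra.
From mathcomp Require Import all_classical all_reals all_analysis.
From mathcomp Require Import fintype finset zify ring lra.

Set Implicit Arguments.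
Unset Strict Implicit.
Unset Printing Implicit Defensive.
Import Order.TTheory GRing.Theory Num.Theory.

Local Open Scope ring_scope.

(** * Colliding particles and singly occupied places *)

Section Collisions.
Context {I V : finType}.
Implicit Types (D E : {set I}) (y : {ffun I -> V}) (i j : I) (v : V).

Definition update y j v : {ffun I -> V} := [ffun i => if i == j then v else y i].

Lemma update_id y j : update y j (y j) = y.
Proof. by apply/ffunP => i; rewrite ffunE; case: eqP => // ->. Qed.

Lemma update_update y j u v : update (update y j u) j v = update y j v.
Proof. by apply/ffunP => i; rewrite !ffunE; case: eqP. Qed.

Lemma update_eq y j v : update y j v j = v.
Proof. by rewrite ffunE eqxx. Qed.

Lemma update_neq y j v i : i != j -> update y j v i = y i.
Proof. by rewrite ffunE => /negPf ->. Qed.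

(** Only particles of [D] count, so that [D] can grow as particles are placed one at a time. For [D]
    the full set these are the unhappy particles. *)
Definition colliding D y : {set I} :=
  [set i in D | [exists j in D, (j != i) && (y j == y i)]].

Lemma collidingP D y i :
  reflect (i \in D /\ exists j, [/\ j \in D, j != i & y j = y i])
          (i \in colliding D y).
Proof.
rewrite inE; apply: (iffP andP) => -[iD].
  by move=> /existsP[j /and3P[jD ji /eqP yji]]; split=> //; exists j.
move=> [j [jD ji yji]]; split=> //; apply/existsP; exists j.
by rewrite jD ji yji eqxx.
Qed.

Lemma colliding_update D y j v :
  j \notin D -> colliding D (update y j v) = colliding D y.
Proof.
move=> jD; have upd i : i \in D -> update y j v i = y i.
  by move=> iD; rewrite update_neq //; apply: contraNneq jD => <-.
by apply/setP => i; apply/collidingP/collidingP => -[iD [k [kD ki e]]];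
  split=> //; exists k; rewrite !upd // in e *.
Qed.

Lemma colliding_subset D E y : D \subset E -> colliding D y \subset colliding E y.
Proof.
move=> /subsetP sub; apply/subsetP => i /collidingP[iD [j [jD ji e]]].
by apply/collidingP; split; [exact: sub | exists j; split=> //; exact: sub].
Qed.

Definition isolated_places D y : {set V} := y @: (D :\: colliding D y).

(** Two particles outside [colliding D y] never share a place, so [y] is injective on them. *)
Lemma card_isolated_places D y :
  #|isolated_places D y| = (#|D| - #|colliding D y|)%N.
Proof.
rewrite card_in_imset; last first.
  move=> i j; rewrite !inE => /andP[+ iD] /andP[_ jD] e; rewrite iD /=.
  by move=> ni; apply/eqP; apply: contraNT ni => nij; apply/existsP; exists j;
    rewrite jD e eqxx eq_sym nij.
rewrite cardsD; congr (_ - _)%N; apply: eq_card => i; rewrite !inE.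
by case: (i \in D).
Qed.

(** The two new colliding particles are [j] and the particle [k] that was alone at [v]; earlier
    collisions persist. *)
Lemma card_colliding_isolated D y j v :
  j \notin D -> v \in isolated_places D y ->
  (#|colliding D y| + 2 <= #|colliding (j |: D) (update y j v)|)%N.
Proof.
move=> jD /imsetP[k /setDP[kD kC] vk].
have jk : j != k by apply: contraNneq jD => ->.
have jC : j \notin colliding D y by apply: contraNN jD => /collidingP[].
have uk : update y j v k = update y j v j.
  by rewrite update_eq update_neq 1?eq_sym.
have -> : (#|colliding D y| + 2 = #|j |: (k |: colliding D y)|)%N.
  by rewrite !cardsU1 in_setU1 (negPf jk) (negPf kC) (negPf jC) addnC.
apply: subset_leq_card; apply/subsetP => i; rewrite in_setU1 in_setU1.
case/or3P => [/eqP->|/eqP->|iC].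
- apply/collidingP; rewrite setU11; split=> //; exists k.
  by rewrite setU1r // eq_sym.
- apply/collidingP; rewrite setU1r //; split=> //; exists j.
  by rewrite setU11.
- by rewrite -(@colliding_update _ _ j v) // in iC; apply: subsetP iC;
    apply: colliding_subset; exact: subsetUr.
Qed.

Lemma card_colliding_add D y j v : j \notin D ->
  (#|colliding D y| <= #|colliding (j |: D) (update y j v)|)%N.
Proof.
move=> jD; rewrite -(@colliding_update _ _ j v) //.
by apply: subset_leq_card; apply: colliding_subset; exact: subsetUr.
Qed.

End Collisions.

(** * Expectations for independently placed particles *)

Section ProductExpectation.
Context {R : realFieldType} {I V : finType} (mu : I -> V -> R).
Context (mu_ge0 : forall i v, 0 <= mu i v).
Context (mu_sum1 : forall i, \sum_v mu i v = 1).
Implicit Types (g : {ffun I -> V} -> R).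

(** With [mu := move_prob G x] the weight is [step_prob G x y], so one-step means are of this
    form. *)
Definition expect g := \sum_(y : {ffun I -> V}) (\prod_i mu i (y i)) * g y.

Lemma expect_cst a : expect (fun=> a) = a.
Proof.
by rewrite /expect -mulr_suml -(bigA_distr_bigA mu) big1 ?mul1r.
Qed.

Lemma le_expect g h : (forall y, g y <= h y) -> expect g <= expect h.
Proof.
by move=> gh; apply: ler_sum => y _; apply: ler_wpM2l => //; apply: prodr_ge0.
Qed.

Lemma expectZ a g : expect (fun y => a * g y) = a * expect g.
Proof. by rewrite /expect mulr_sumr; apply: eq_bigr => y _; rewrite mulrCA. Qed.

Lemma expect_sum (J : finType) (P : pred J) (F : J -> {ffun I -> V} -> R) :
  expect (fun y => \sum_(j | P j) F j y) = \sum_(j | P j) expect (F j).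
Proof.
rewrite /expect exchange_big /=; apply: eq_bigr => y _.
by rewrite mulr_sumr.
Qed.

(* The map (y, v) |-> (y with v in coordinate j, y j) is a measure-preserving
   involution of the product of the law of y and of mu j. *)
Lemma expect_resample j g :
  expect g = expect (fun y => \sum_v mu j v * g (update y j v)).
Proof.
rewrite /expect [RHS](eq_bigr (fun y : {ffun I -> V} =>
  \sum_v (\prod_i mu i (y i)) *
  (mu j v * g (update y j v)))); last by move=> y _; rewrite mulr_sumr.
rewrite pair_big /=.
rewrite (reindex (fun p : {ffun I -> V} * V => (update p.1 j p.2, p.1 j))) /=;
  last first.
  by exists (fun p : {ffun I -> V} * V => (update p.1 j p.2, p.1 j)) => -[y v] _ /=;
    rewrite update_eq update_update update_id.
rewrite (eq_bigr (fun p : {ffun I -> V} * V =>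
  mu j p.2 * ((\prod_i mu i (p.1 i)) * g p.1))); last first.
  move=> [y v] _ /=; rewrite update_update update_id.
  rewrite (bigD1 j) //= [in RHS](bigD1 j) //= update_eq.
  rewrite (eq_bigr (fun i => mu i (y i))); first by ring.
  by move=> i ij; rewrite update_neq.
rewrite -(pair_big xpredT xpredT (fun (y : {ffun I -> V}) v =>
   mu j v * ((\prod_i mu i (y i)) * g y))) /=.
by apply: eq_bigr => y _; rewrite -mulr_suml mu_sum1 mul1r.
Qed.

(** Once the other particles are fixed, [j] collides only by landing in the set [O] of their places,
    which has at most [#|I| - 1] elements of mass at most [K] each. *)
Lemma expect_colliding j K : 0 <= K -> (forall v, mu j v <= K) ->
  expect (fun y => (j \in colliding setT y)%:R) <= #|I|.-1%:R * K.
Proof.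
move=> K0 muK; rewrite (expect_resample j) -[leRHS]expect_cst.
apply: le_expect => y; pose O := y @: [set~ j].
apply: (@le_trans _ _ (\sum_(v in O) K)); last first.
  rewrite sumr_const -(mulr_natl K) ler_wpM2r // ler_nat.
  by rewrite (leq_trans (leq_imset_card _ _)) // cardsC1.
rewrite [leRHS]big_mkcond /=; apply: ler_sum => v _.
case: ifPn => [_|vO].
  rewrite -[leRHS]mulr1; apply: ler_pM => //.
  by rewrite lern1; case: (_ \in _).
rewrite [X in X%:R](_ : _ = 0%N) ?mulr0 //.
apply/eqP; rewrite eqb0; apply: contraNN vO => /collidingP[_ [k [_ kj]]].
rewrite update_eq update_neq // => <-; apply: imset_f.
by rewrite !inE.
Qed.

(* An upper bound for the indicator of k < m that loses a factor z ^+ 2 whenever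
   k grows by 2. *)
Definition deficit_weight (z : R) (m k : nat) : R :=
  if (k < m)%N then z^-1 ^+ (m - k) else 0.

Section Deficit.
Context (z : R) (m : nat).
Context (z_gt0 : 0 < z).
Context (z_le1 : z <= 1).
Let w := deficit_weight z m.

Let zV_ge1 : 1 <= z^-1. Proof. by rewrite invf_ge1. Qed.

Lemma deficit_weight_ge0 k : 0 <= w k.
Proof.
by rewrite /w /deficit_weight; case: ifP => // _; rewrite exprn_ge0 ?invr_ge0 ?ltW.
Qed.

Lemma deficit_weight_decr k l : (k <= l)%N -> w l <= w k.
Proof.
move=> kl; rewrite {1}/w /deficit_weight; case: ifPn => lm; last first.
  exact: deficit_weight_ge0.
rewrite /w /deficit_weight (leq_ltn_trans kl lm); apply: ler_weXn2l => //.
by lia.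
Qed.

Lemma deficit_weight_add2 k : w (k + 2) <= z ^+ 2 * w k.
Proof.
have [km|km] := ltnP (k + 2) m; last first.
  rewrite {1}/w /deficit_weight ltnNge km /=.
  by rewrite mulr_ge0 ?exprn_ge0 ?deficit_weight_ge0 // ltW.
rewrite /w /deficit_weight km (_ : (k < m)%N); last by lia.
rewrite (_ : (m - k = 2 + (m - (k + 2)))%N); last by lia.
by rewrite exprD mulrA -exprMn divff ?gt_eqF // expr1n mul1r.
Qed.

Lemma deficit_weight_ge_ind k : (k < m)%:R <= w k.
Proof.
rewrite /w /deficit_weight; case: ifP => // _.
exact: exprn_ege1.
Qed.

Lemma deficit_weight_le k : w k <= z^-1 ^+ m.
Proof.
apply: le_trans (deficit_weight_decr (leq0n k)) _; rewrite /w /deficit_weight subn0.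
by case: ifP => // _; rewrite exprn_ge0 ?invr_ge0 ?ltW.
Qed.

Context (p : R).
Context (p_ge0 : 0 <= p).
Let q := 1 - p * (1 - z ^+ 2).

(** If [m] particles already collide, both weights vanish. Otherwise at least [#|I| - 2m] places are
    isolated, so [j] hits one with probability at least [p] and the weight then drops by [z ^+ 2];
    [q] is the average [(1 - p) + p * z ^+ 2]. *)
Lemma expect_place_one (D : {set I}) (j : I) :
  j \notin D -> (#|I| - m <= #|D|)%N ->
  (forall A : {set V}, (#|I| - 2 * m <= #|A|)%N -> p <= \sum_(v in A) mu j v) ->
  expect (fun y => w #|colliding (j |: D) y|) <=
  q * expect (fun y => w #|colliding D y|).
Proof.
move=> jD cD pA; rewrite (expect_resample j) -expectZ; apply: le_expect => y.
set c := #|colliding D y|.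
have [cm|cm] := ltnP c m; last first.
  have w0 k : (m <= k)%N -> w k = 0 by rewrite /w /deficit_weight ltnNge => ->.
  rewrite w0 // mulr0 big1 // => v _; rewrite w0 ?mulr0 //.
  exact: leq_trans cm (card_colliding_add _ _ jD).
pose A := isolated_places D y.
have {}pA : p <= \sum_(v in A) mu j v.
  by apply: pA; rewrite card_isolated_places -/c; lia.
apply: (@le_trans _ _ (\sum_v mu j v * (w c - (v \in A)%:R * ((1 - z ^+ 2) * w c)))).
  apply: ler_sum => v _; apply: ler_wpM2l => //.
  case: (boolP (v \in A)) => vA.
    rewrite mul1r (_ : _ - _ = z ^+ 2 * w c); last by ring.
    apply: le_trans (deficit_weight_add2 c); apply: deficit_weight_decr.
    exact: card_colliding_isolated.
  by rewrite mul0r subr0; apply: deficit_weight_decr; exact: card_colliding_add.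
rewrite (eq_bigr (fun v => mu j v * w c -
   (if v \in A then mu j v else 0) * ((1 - z ^+ 2) * w c))); last first.
  by move=> v _; case: ifP => _; rewrite ?mul1r ?mul0r; ring.
rewrite big_split /= -mulr_suml mu_sum1 sumrN -mulr_suml -big_mkcond /=.
have -> : q * w c = 1 * w c - p * ((1 - z ^+ 2) * w c) by rewrite /q; ring.
rewrite lerD2l lerN2 ler_wpM2r // mulr_ge0 ?deficit_weight_ge0 // subr_ge0.
by rewrite expr_le1 // ltW.
Qed.

(* Place the particles of T last, one at a time. As long as fewer than m
   particles collide, at least #|I| - 2m places hold exactly one particle, and
   hitting one of them creates two colliding particles at once. *)
Lemma expect_few_colliding (T : {set I}) : #|T| = m -> 0 <= q ->
  (forall (j : I) (A : {set V}), j \in T -> (#|I| - 2 * m <= #|A|)%N ->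
     p <= \sum_(v in A) mu j v) ->
  expect (fun y => (#|colliding setT y| < m)%:R) <= (q / z) ^+ m.
Proof.
move=> cT q0 pT.
(* [U] is the set of particles still to be placed; each contributes one factor [q]. *)
have step k (U : {set I}) : #|U| = k -> U \subset T ->
    expect (fun y => w #|colliding setT y|) <=
    q ^+ k * expect (fun y => w #|colliding (~: U) y|).
  elim: k U => [|k IH] U cU UT.
    by rewrite (cards0_eq cU) setC0 expr0 mul1r.
  have /card_gt0P[j jU] : (0 < #|U|)%N by rewrite cU.
  have cUj : #|U :\ j| = k by have := cardsD1 j U; rewrite cU jU => -[].
  have {IH} := IH _ cUj (subset_trans (subsetDl _ _) UT).
  move=> /le_trans; apply; rewrite exprSr -mulrA ler_wpM2l ?exprn_ge0 //.
  rewrite (_ : ~: (U :\ j) = j |: ~: U); last first.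
    by apply/setP => i; rewrite !inE negb_and negbK.
  apply: expect_place_one.
  - by rewrite inE jU.
  - have := subset_leq_card UT; have := cardsC U; rewrite cT; lia.
  - by move=> A; apply: pT; apply: subsetP jU.
apply: (@le_trans _ _ (expect (fun y => w #|colliding setT y|))).
  by apply: le_expect => y; exact: deficit_weight_ge_ind.
apply: le_trans (step _ _ cT (subxx _)) _.
rewrite exprMn ler_wpM2l ?exprn_ge0 // -[leRHS]expect_cst.
by apply: le_expect => y; exact: deficit_weight_le.
Qed.

End Deficit.
End ProductExpectation.

(** * One step of the process on a general graph *)

Section Step.
Context {V : finType} {M : nat} {R : realType} (G : rel V).
Implicit Types (x y : {ffun 'I_M -> V}) (i j : 'I_M) (v : V).

Local Notation unhappy x := (colliding [set: 'I_M] x).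
Local Notation step x y := (step_prob G x y : R).

Lemma unhappyE x i : (1 < occupancy x (x i))%N = (i \in unhappy x).
Proof.
rewrite /occupancy (cardD1 i) inE eqxx ltnS lt0n.
apply/pred0Pn/collidingP => [[j]|[_ [j [_ ji xji]]]].
  by rewrite !inE => /andP[ji /eqP xji]; split=> //; exists j; rewrite inE.
by exists j; rewrite !inE ji xji eqxx.
Qed.

Lemma dispersedP x : dispersed x <-> unhappy x = set0.
Proof.
split=> [dx|x0 v].
  by apply/setP => i; rewrite -unhappyE in_set0 ltnNge dx.
rewrite leqNgt; apply/negP => gt1.
have /card_gt0P[i] : (0 < occupancy x v)%N by exact: leq_trans gt1.
rewrite inE => /eqP xi; move: gt1.
by rewrite -xi unhappyE x0 inE.
Qed.

Lemma move_prob_happy x i v : i \notin unhappy x ->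
  move_prob G x i v = (v == x i)%:R :> R.
Proof. by rewrite /move_prob unhappyE => /negPf ->. Qed.

Lemma move_prob_unhappy x i v : i \in unhappy x ->
  move_prob G x i v = (if G (x i) v then (degree G (x i))%:R^-1 else 0) :> R.
Proof. by rewrite /move_prob unhappyE => ->. Qed.

Lemma move_prob_ge0 x i v : 0 <= move_prob G x i v :> R.
Proof. by rewrite /move_prob; do 2?case: ifP => // _; rewrite invr_ge0. Qed.

Lemma step_prob_ge0 x y : 0 <= step x y.
Proof. by apply: prodr_ge0 => i _; exact: move_prob_ge0. Qed.

Lemma step_prob_neq0 x y : step x y != 0 ->
  (forall i, i \notin unhappy x -> y i = x i) /\
  (forall i, i \in unhappy x -> G (x i) (y i)).
Proof.
move=> /prodf_neq0 s0; split=> i ix; have := s0 i isT.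
  by rewrite move_prob_happy // pnatr_eq0 eqb0 negbK => /eqP.
by rewrite move_prob_unhappy //; case: ifP => //; rewrite eqxx.
Qed.

(* The configurations from which every unhappy particle has #|V| - 1 equally
   likely destinations. *)
Definition hub x : bool := [forall i in unhappy x, degree G (x i) == #|V|.-1].

Lemma hubP x : reflect (forall i, i \in unhappy x -> degree G (x i) = #|V|.-1) (hub x).
Proof. by apply: (iffP forall_inP) => h i ix; apply/eqP; rewrite h. Qed.

(** This models the steps of the star towards the centre: nothing is gained or lost, and a
    productive step follows. *)
Definition relay x : Prop :=
  forall y, step x y != 0 -> hub y /\ #|unhappy y| = #|unhappy x|.

(** Resting particles have distinct places, so a newly unhappy one shares its place with a particle
    that moved and is still unhappy. Sending each newly unhappy particle to its place is injective,
    so these are no more numerous than the particles that stay unhappy. *)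
Lemma unhappy_step x y : (forall i, i \notin unhappy x -> y i = x i) ->
  (#|unhappy y| <= 2 * #|unhappy x :&: unhappy y|)%N.
Proof.
move=> stay; rewrite -(cardsID (unhappy x) (unhappy y)) [in leqRHS]setIC mul2n -addnn.
rewrite leq_add2l; set N := _ :\: _.
have yxN i : i \in N -> y i = x i by case/setDP => _; exact: stay.
rewrite -(@card_in_imset _ _ y N); last first.
  move=> i j iN jN; rewrite !yxN // => xij; apply/eqP; apply: contraTT iN => nij.
  rewrite inE negb_and negbK; apply/orP; left.
  by apply/collidingP; split=> //; exists j; rewrite inE eq_sym.
apply: leq_trans (leq_imset_card y _); apply: subset_leq_card.
apply/subsetP => _ /imsetP[i iN ->].
have /setDP[/collidingP[_ [j [_ ji yji]]] ix] := iN.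
rewrite -yji; apply: imset_f; apply/setIP; split.
  by apply/collidingP; split=> //; exists i; rewrite inE eq_sym.
apply: contraT => jx; case/negP: ix; apply/collidingP; split=> //; exists j.
by rewrite inE -(stay _ jx) yji yxN.
Qed.

Context (degree_gt0 : forall v, (0 < degree G v)%N).

Lemma move_prob_sum1 x i : \sum_v move_prob G x i v = 1 :> R.
Proof.
have [ix|ix] := boolP (i \in unhappy x); last first.
  rewrite (bigD1 (x i)) //= big1 => [|v /negPf vx]; rewrite move_prob_happy //.
    by rewrite eqxx addr0.
  by rewrite vx.
under eq_bigr do rewrite move_prob_unhappy //.
rewrite -big_mkcond sumr_const -[X in X *+ _]mul1r -mulrnAr -mulr_natl mul1r.
by rewrite mulfV // pnatr_eq0 -lt0n degree_gt0.
Qed.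

Lemma step_prob_sum1 x : \sum_y step x y = 1.
Proof.
rewrite -[RHS](expect_cst (move_prob_sum1 x) 1).
by apply: eq_bigr => y _; rewrite mulr1.
Qed.

(** [unhappy_step] reduces the count to the moving particles that collide, at the price of the
    factor 2, and [expect_colliding] bounds the probability for each of them. *)
Lemma hub_unhappy_mean x : hub x ->
  \sum_y step x y * #|unhappy y|%:R <=
  2 * (M.-1%:R / #|V|.-1%:R) * #|unhappy x|%:R.
Proof.
move=> /hubP hx; set K : R := #|V|.-1%:R^-1.
pose c y := 2 * \sum_(i in unhappy x) (i \in unhappy y)%:R : R.
apply: (@le_trans _ _ (\sum_y step x y * c y)).
  apply: ler_sum => y _; have [->|/step_prob_neq0[stay _]] := eqVneq (step x y) 0.
    by rewrite !mul0r.
  apply: ler_wpM2l; first exact: step_prob_ge0.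
  rewrite /c -natr_sum -natrM ler_nat; apply: leq_trans (unhappy_step stay) _.
  rewrite leq_mul2l /= -sum1_card big_mkcond [leqRHS]big_mkcond /=.
  by apply: leq_sum => i _; rewrite inE; case: (i \in unhappy x); case: (i \in _).
rewrite -[leLHS]/(expect (move_prob G x) c) expectZ expect_sum -mulrA.
rewrite ler_wpM2l // mulr_natr -sumr_const; apply: ler_sum => i ix.
have K0 : 0 <= K by rewrite invr_ge0.
have := expect_colliding (@move_prob_ge0 x) (move_prob_sum1 x) (j := i) K0.
rewrite card_ord; apply=> v; rewrite move_prob_unhappy // hx //.
by case: ifP.
Qed.

Lemma hub_few_unhappy x m (p z : R) :
  hub x -> (m <= #|unhappy x|)%N -> 0 < z <= 1 -> 0 <= p <= 1 ->
  p * #|V|.-1%:R <= (M - 2 * m).-1%:R ->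
  \sum_y step x y * (#|unhappy y| < m)%:R <= ((1 - p * (1 - z ^+ 2)) / z) ^+ m.
Proof.
move=> /hubP hx /card_geqP[s [us sm sx]] /andP[z0 z1] /andP[p0 p1] pV.
pose T := [set i in s].
have Tx i : i \in T -> i \in unhappy x by rewrite inE => /sx.
have cT : #|T| = m by rewrite cardsE (card_uniqP us).
rewrite -[leLHS]/(expect (move_prob G x) (fun y => (#|unhappy y| < m)%:R)).
apply: (expect_few_colliding (@move_prob_ge0 x) (move_prob_sum1 x) z0 z1 p0 cT).
  by rewrite subr_ge0 mulr_ile1 // ?subr_ge0 ?gerBl ?exprn_ge0 ?expr_le1 // ltW.
move=> j A /Tx jx cA; rewrite card_ord in cA.
have dx := hx _ jx; have d0 := degree_gt0 (x j).
under eq_bigr do rewrite move_prob_unhappy //.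
rewrite -big_mkcondr sumr_const /= dx.
rewrite -[X in X *+ _]mul1r -mulrnAr -mulr_natl mul1r ler_pdivlMr; last first.
  by rewrite -dx ltr0n.
apply: le_trans pV _; rewrite ler_nat.
(* A vertex of degree [#|V| - 1] has exactly one non-neighbour (counting itself), so at most one
   place of [A] is out of reach; hence the predecessor in the hypothesis on [p]. *)
have := cardsC [set v | G (x j) v]; have -> : #|[set v | G (x j) v]| = #|V|.-1.
  by rewrite cardsE -dx.
have -> : #|[pred v in A | G (x j) v]| = #|A :&: [set v | G (x j) v]|.
  by apply: eq_card => v; rewrite !inE.
have := cardsID [set v | G (x j) v] A.
have : (#|A :\: [set v | G (x j) v]| <= #|~: [set v | G (x j) v]|)%N.
  by rewrite subset_leq_card // setDE subsetIr.
rewrite dx in d0; move: cA d0.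
move: #|_ :&: _| #|_ :\: _| #|~: _| #|A| #|V| => a b c d e; lia.
Qed.

End Step.

(** * The complete graph and the star *)

Lemma degree_complete n (v : 'I_n) : degree (complete_graph n) v = n.-1.
Proof.
rewrite /degree -[in RHS](card_ord n) -(cardC1 v).
by apply: eq_card => u; rewrite !inE /complete_graph eq_sym.
Qed.

Lemma degree_star_centre n (v : 'I_n) : val v = 0%N -> degree (star_graph n) v = n.-1.
Proof.
move=> v0; rewrite -(degree_complete v); apply: eq_card => u.
by rewrite !inE /star_graph v0 andbT.
Qed.

Lemma degree_star_leaf n (v : 'I_n) : val v != 0%N -> degree (star_graph n) v = 1%N.
Proof.
move=> v0; have n0 : (0 < n)%N by case: n v {v0} => [[]|].
rewrite /degree -(card1 (Ordinal n0)); apply: eq_card => u.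
rewrite !inE /star_graph (negPf v0) /=.
apply/andP/eqP => [[_ /eqP u0]|->]; first exact: val_inj.
by split=> //; apply: contraNneq v0 => ->.
Qed.

Section Graphs.
Context {R : realType} {n M : nat} (G : rel 'I_n).
Context (GE : G = complete_graph n \/ G = star_graph n) (n_gt2 : (2 < n)%N).
Implicit Types (x y : {ffun 'I_M -> 'I_n}).
Local Notation unhappy x := (colliding [set: 'I_M] x).
Local Notation step x y := (step_prob G x y : R).

Lemma degree_gt0 v : (0 < degree G v)%N.
Proof.
case: GE => ->; first by rewrite degree_complete; lia.
have [v0|v0] := eqVneq (val v) 0%N; last by rewrite degree_star_leaf.
by rewrite degree_star_centre //; lia.
Qed.

Lemma hub_complete x : G = complete_graph n -> hub G x.
Proof. by move=> ->; apply/hubP => i _; rewrite degree_complete card_ord. Qed.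

(** For [n > 2] the degree 1 of a leaf differs from [n - 1]. *)
Lemma hub_star x : G = star_graph n ->
  hub G x = [forall i in unhappy x, val (x i) == 0%N].
Proof.
move=> GS; apply/hubP/forall_inP => h i /h; rewrite GS card_ord.
  by apply: contra_eqT => xi; rewrite degree_star_leaf //; lia.
by move=> /eqP; exact: degree_star_centre.
Qed.

(* After a step from a configuration with an empty centre, exactly the unhappy
   particles sit at the centre. *)
Lemma relay_leaves x : G = star_graph n -> (forall i, val (x i) != 0%N) ->
  relay (R := R) G x.
Proof.
move=> GS leaf y /step_prob_neq0[stay move].
have y0 i : i \in unhappy x -> val (y i) = 0%N.
  move=> /move; rewrite GS /star_graph (negPf (leaf i)) /=.
  by case/andP => _ /eqP.
have yN0 i : i \notin unhappy x -> val (y i) != 0%N.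
  by move=> /stay ->.
have E : unhappy y = unhappy x.
  apply/setP => i; apply/idP/idP => [|ix]; last first.
    have /collidingP[_ [j [_ ji xji]]] := ix.
    apply/collidingP; split=> //; exists j; rewrite inE; split=> //.
    apply: val_inj; rewrite /= !y0 //.
    by apply/collidingP; split=> //; exists i; rewrite inE eq_sym.
  apply: contraLR => ix; apply/negP => /collidingP[_ [j [_ ji yji]]].
  case: (boolP (j \in unhappy x)) => jx.
    by have := yN0 _ ix; rewrite -yji y0.
  case/negP: ix; apply/collidingP; split=> //; exists j.
  by rewrite inE -(stay j) // yji; split=> //; apply: stay; apply/negP => ix;
    have := yN0 _ jx; rewrite yji y0.
by split; [rewrite hub_star // E; apply/forall_inP => i ix; rewrite y0 | rewrite E].
Qed.

(** On the star all unhappy particles sit at the centre and leave it. If there is one, no happy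
    particle can be at the centre, which is thus empty after the step; if there is none, the
    configuration is frozen. *)
Lemma hub_step x y : hub G x -> step x y != 0 -> hub G y \/ relay (R := R) G y.
Proof.
case: GE => [GC _ _|GS]; first by left; exact: hub_complete.
move=> hx /step_prob_neq0[stay move].
move: (hx); rewrite hub_star // => /forall_inP x0.
have [ux|] := eqVneq (unhappy x) set0.
  left; rewrite (_ : y = x) //; apply/ffunP => i.
  by rewrite stay // ux inE.
case/set0Pn => j jx; right; apply: relay_leaves => // i.
case: (boolP (i \in unhappy x)) => ix.
  have := move _ ix; rewrite GS => /andP[+ _]; apply: contraNneq => yi.
  by apply/eqP/val_inj; rewrite /= yi; apply/eqP; exact: x0.
have ji : j != i by apply: contraNneq ix => <-.
rewrite stay //; apply: contraNneq ix => xi; apply/collidingP; split=> //.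
exists j; rewrite inE; split=> //.
by apply: val_inj; rewrite /= xi; exact/eqP/x0.
Qed.

Lemma hub_or_relay_const o (x := [ffun=> o] : {ffun 'I_M -> 'I_n}) :
  hub G x \/ relay (R := R) G x.
Proof.
case: GE => [GC|GS]; first by left; exact: hub_complete.
have [centre|leaf] := eqVneq (val o) 0%N.
  by left; rewrite hub_star //; apply/forall_inP => i _; rewrite ffunE centre.
by right; apply: relay_leaves => // i; rewrite ffunE.
Qed.

End Graphs.

(** * Finite Markov chains with an invariant *)

Section FiniteChain.
Context {R : realFieldType} {S : finType} (K : S -> S -> R) (p : nat -> S -> R).
Context (x0 : S) (K_ge0 : forall x y, 0 <= K x y).
Context (K_sum1 : forall x, \sum_y K x y = 1).
Context (p_0 : forall x, p 0 x = (x == x0)%:R).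
Context (p_S : forall t y, p t.+1 y = \sum_x p t x * K x y).

Lemma chain_ge0 t x : 0 <= p t x.
Proof.
elim: t x => [|t IH] x; first by rewrite p_0.
by rewrite p_S; apply: sumr_ge0 => y _; rewrite mulr_ge0.
Qed.

Lemma chain_mean0 f : \sum_x p 0 x * f x = f x0.
Proof.
rewrite (bigD1 x0) //= p_0 eqxx mul1r big1 ?addr0 // => x /negPf xx0.
by rewrite p_0 xx0 mul0r.
Qed.

Lemma chain_meanS t f :
  \sum_x p t.+1 x * f x = \sum_x p t x * \sum_y K x y * f y.
Proof.
under eq_bigr do rewrite p_S mulr_suml.
rewrite exchange_big /=; apply: eq_bigr => x _.
by rewrite mulr_sumr; apply: eq_bigr => y _; rewrite mulrA.
Qed.

Lemma chain_sum1 t : \sum_x p t x = 1.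
Proof.
elim: t => [|t IH].
  by have := chain_mean0 (fun=> 1); under eq_bigr do rewrite mulr1.
have := chain_meanS t (fun=> 1); under eq_bigr do rewrite mulr1.
move=> ->; rewrite -[RHS]IH; apply: eq_bigr => x _.
by under eq_bigr do rewrite mulr1; rewrite K_sum1 mulr1.
Qed.

Context (inv : S -> Prop) (inv_start : inv x0).
Context (inv_step : forall x y, inv x -> K x y != 0 -> inv y).

Lemma chain_inv t x : p t x != 0 -> inv x.
Proof.
elim: t x => [|t IH] x; first by rewrite p_0 pnatr_eq0 eqb0 negbK => /eqP ->.
rewrite p_S psumr_neq0 => [/hasP[y _ /andP[_ /[dup]]]|y _]; last first.
  by rewrite mulr_ge0 ?chain_ge0.
move=> /lt0r_neq0; rewrite mulf_eq0 negb_or => /andP[/IH iy Kyx] _.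
exact: inv_step Kyx.
Qed.

Lemma le_chain_mean t f g : (forall x, inv x -> f x <= g x) ->
  \sum_x p t x * f x <= \sum_x p t x * g x.
Proof.
move=> fg; apply: ler_sum => x _; have [->|/chain_inv ix] := eqVneq (p t x) 0.
  by rewrite !mul0r.
by rewrite ler_wpM2l ?chain_ge0 ?fg.
Qed.

Lemma chain_decay (g : S -> R) (lambda : R) t : 0 <= lambda ->
  (forall x, inv x -> \sum_y K x y * g y <= lambda * g x) ->
  \sum_x p t x * g x <= lambda ^+ t * g x0.
Proof.
move=> l0 gK; elim: t => [|t IH]; first by rewrite chain_mean0 mul1r.
rewrite chain_meanS; apply: le_trans (le_chain_mean t gK) _.
under eq_bigr do rewrite mulrCA; rewrite -mulr_sumr exprS -mulrA.
exact: ler_wpM2l.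
Qed.

(** Each step raises the mass of [bad] by at most [r]: the part already bad is counted in full, the
    rest enters [bad] with conditional probability at most [r]. *)
Lemma chain_escape (bad : pred S) (r : R) t : 0 <= r -> ~~ bad x0 ->
  (forall x, inv x -> ~~ bad x -> \sum_y K x y * (bad y)%:R <= r) ->
  \sum_x p t x * (bad x)%:R <= t%:R * r.
Proof.
move=> r0 bx0 badK; elim: t => [|t IH].
  by rewrite chain_mean0 (negPf bx0) mul0r.
rewrite chain_meanS; apply: (@le_trans _ _ (\sum_x p t x * ((bad x)%:R + r))).
  apply: le_chain_mean => x ix; have [bx|bx] := boolP (bad x).
    apply: (@le_trans _ _ 1); last by rewrite lerDl.
    rewrite -[leRHS](K_sum1 x); apply: ler_sum => y _.
    by rewrite ler_piMr // lern1 leq_b1.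
  by rewrite add0r badK.
under eq_bigr do rewrite mulrDr; rewrite big_split /= -mulr_suml chain_sum1 mul1r.
by rewrite -addn1 natrD mulrDl mul1r lerD2r.
Qed.

End FiniteChain.

Local Open Scope classical_set_scope.

(** * The law of the process and the dispersion time *)

Section Law.
Context {V : finType} {M : nat} {R : realType} {G : rel V}.
Context {d : measure_display} {Omega : measurableType d}.
Context {P : probability Omega R} {o : V} {X : nat -> Omega -> config V M}.
Context (procX : dispersion_process G P o X).
Local Notation S := {ffun 'I_M -> V}.

Definition law t (x : S) : R := fine (P [set w | X t w = x]).

Lemma measurable_state t x : measurable [set w | X t w = x].
Proof. by case: procX. Qed.

Lemma lawE t x : P [set w | X t w = x] = (law t x)%:E.
Proof. by rewrite fineK // fin_num_measure //; exact: measurable_state. Qed.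

Lemma measurable_pred t (Q : S -> Prop) : measurable [set w | Q (X t w)].
Proof.
rewrite (_ : [set w | _] = \bigcup_(x in [set x : S | Q x]) [set w | X t w = x]).
  apply: fin_bigcup_measurable => [|x _]; first exact: finite_finset.
  exact: measurable_state.
apply/seteqP; split=> w /=; first by move=> Qw; exists (X t w).
by case=> x Qx ->.
Qed.

Lemma prob_partition t A : measurable A ->
  P A = (\sum_(x : S) P (A `&` [set w | X t w = x]))%E.
Proof.
move=> mA; rewrite -[LHS](congr1 P (_ : \bigcup_(x in [set` index_enum S])
   (A `&` [set w | X t w = x]) = A)); last first.
  apply/seteqP; split=> w; first by case=> x _ [].
  by move=> Aw; exists (X t w) => //=; rewrite mem_index_enum.
rewrite measure_fin_bigcup //.
- by rewrite -fsbig_seq // index_enum_uniq.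
- by move=> x y _ _ [w [[_ <-] [_ <-]]].
- by move=> x _; apply: measurableI => //; exact: measurable_state.
Qed.

Lemma prob_pred t (Q : pred S) :
  P [set w | Q (X t w)] = (\sum_x law t x * (Q x)%:R)%:E.
Proof.
rewrite (prob_partition t); last exact: (measurable_pred t Q).
rewrite -sumEFin; apply: eq_bigr => x _.
have [Qx|Qx] := boolP (Q x).
  rewrite mulr1 -lawE; congr (P _); apply/seteqP.
  by split=> w /=; [case | move=> e; rewrite e].
rewrite mulr0 (_ : _ `&` _ = classical_sets.set0) ?measure0 //.
by apply/seteqP; split=> // w [/= Qw e]; rewrite -e Qw in Qx.
Qed.

Lemma law_start x : law 0 x = (x == [ffun=> o])%:R.
Proof.
have P0 : P [set w | X 0%N w = [ffun=> o]] = 1%E by case: procX.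
have [->|xo] := eqVneq; first by rewrite /law P0.
have := probability_setC P (measurable_state 0 [ffun=> o]).
rewrite P0 subee // => C0; apply: EFin_inj; rewrite mulr0n -lawE.
apply/eqP; rewrite eq_le measure_ge0 andbT -[leRHS]C0; apply: le_measure.
- by apply: mem_set; exact: measurable_state.
- by apply: mem_set; apply: measurableC; exact: measurable_state.
- by move=> w /= ->; exact/eqP.
Qed.

(** The Markov property is given for paths from time 0. Summing over the state at time [k] drops
    that time from the window, so induction on [k] applies. *)
Lemma prob_window k t (x : nat -> S) : (k <= t)%N ->
  P [set w | forall s, (k <= s <= t.+1)%N -> X s w = x s] =
  (P [set w | forall s, (k <= s <= t)%N -> X s w = x s]
   * (step_prob G (x t) (x t.+1))%:E)%E.
Proof.
have window_measurable a b (y : nat -> S) :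
    measurable [set w | forall s, (a <= s <= b)%N -> X s w = y s].
  rewrite (_ : [set w | _] =
     \bigcap_(s in [set s | (a <= s <= b)%N]) [set w | X s w = y s]) //.
  apply: bigcap_measurableType => s _; exact: measurable_state.
elim: k x => [|k IH] x kt.
  by case: procX => _ _ /(_ t x).
(* Prescribing [v] at time [k] gives a window starting at [k] for the path modified there. As
   [k < t], the last transition is unaffected. *)
have extend b (v : S) : (k <= b)%N ->
    [set w | forall s, (k < s <= b)%N -> X s w = x s] `&` [set w | X k w = v] =
    [set w | forall s, (k <= s <= b)%N -> X s w = if s == k then v else x s].
  move=> kb; apply/seteqP; split=> w /= => [[h e] s /andP[ks sb]|h].
    by case: eqP => [->//|/eqP sk]; apply: h; rewrite sb andbT ltn_neqAle eq_sym sk.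
  split=> [s /andP[ks sb]|].
    by rewrite h ?sb ?(ltnW ks) // gtn_eqF.
  by rewrite h ?leqnn // eqxx.
rewrite (prob_partition k) // [X in (X * _)%E](prob_partition k) //.
rewrite ge0_sume_distrl => [|v _]; last exact: measure_ge0.
apply: eq_bigr => v _; rewrite !extend; [|lia..].
rewrite IH; last by lia.
by rewrite !gtn_eqF //; lia.
Qed.

Lemma law_step t y : law t.+1 y = \sum_x law t x * step_prob G x y.
Proof.
apply: EFin_inj; rewrite -lawE (prob_partition t); last exact: measurable_state.
rewrite -sumEFin; apply: eq_bigr => x _.
pose z s := if s == t then x else y.
have := prob_window z (leqnn t); rewrite /z eqxx gtn_eqF // EFinM -lawE => e.
rewrite -[RHS](_ : (P [set w | forall s, (t <= s <= t)%N ->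
   X s w = if s == t then x else y] * (step_prob G x y)%:E = _)%E); last first.
  congr (P _ * _)%E; apply/seteqP; split=> w /= => [/(_ t)|h s].
    by rewrite leqnn eqxx; apply.
  by rewrite -eqn_leq => /eqP <-; rewrite eqxx.
rewrite -e; congr (P _); apply/seteqP; split=> w /= => [[h1 h2] s|h].
  have [->//|st] := eqVneq s t.
  by move=> h; rewrite (_ : s = t.+1) //; lia.
split; first by rewrite h ?leqnn ?leqnSn // gtn_eqF.
by rewrite h ?leqnn ?leqnSn // eqxx.
Qed.

Local Notation unhappy x := (colliding finset.setT x).

Lemma dispersion_time_le (r : R) : 0 <= r ->
  [set w | (dispersion_time X w <= r%:E)%E] =
  \bigcup_(s < (Num.truncn r).+1) [set w | #|unhappy (X s w)| == 0%N].
Proof.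
move=> r0; apply/seteqP; split=> w /=; last first.
  case=> s /= sr /eqP/cards0_eq/dispersedP ds.
  apply: (@le_trans _ _ s%:R%:E); first by apply: ereal_inf_lbound; exists s.
  by rewrite lee_fin -truncn_ge_nat // -ltnS.
move=> Tr; apply: contrapT => nd.
(* Dispersion times are integers: with none up to [truncn r], the infimum is at least
   [truncn r + 1], which exceeds [r]. This also covers the empty set. *)
have : (((Num.truncn r).+1%:R : R)%:E <= dispersion_time X w)%E.
  rewrite /dispersion_time; apply: le_ereal_inf_tmp => _ [s /= /dispersedP ds <-].
  rewrite lee_fin ler_nat ltnNge; apply/negP => sr; apply: nd.
  by exists s => //=; rewrite ds cards0.
move=> /le_trans /(_ Tr); rewrite lee_fin leNgt => /negP; apply.
exact: truncnS_gt.
Qed.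

Lemma dispersion_time_measurable (r : R) : 0 <= r ->
  measurable [set w | (dispersion_time X w <= r%:E)%E].
Proof.
move=> r0; rewrite dispersion_time_le //; apply: fin_bigcup_measurable => //.
by move=> s _; exact: (measurable_pred s (fun x => #|unhappy x| == 0%N)).
Qed.

Lemma prob_dispersed_late (r : R) : 0 <= r ->
  ((1 - \sum_x law (Num.truncn r) x * (#|unhappy x| != 0%N)%:R)%:E <=
   P [set w | (dispersion_time X w <= r%:E)%E])%E.
Proof.
move=> r0; set t := Num.truncn r.
have := probability_setC P
  (measurable_pred t (fun x => #|unhappy x| != 0%N)).
rewrite (prob_pred t (fun x => #|unhappy x| != 0%N)) -EFinB => <-; apply: le_measure.
- apply: mem_set; apply: measurableC.
  exact: (measurable_pred t (fun x => #|unhappy x| != 0%N)).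
- by apply: mem_set; exact: dispersion_time_measurable.
- move=> w /= /negP; rewrite negbK => ds.
  have : [set w | (dispersion_time X w <= r%:E)%E] w; last by [].
  by rewrite dispersion_time_le //; exists t; rewrite /= ?ltnSn.
Qed.

(** A union bound over the times up to [truncn r]. *)
Lemma prob_dispersed_early (r : R) : 0 <= r ->
  (P [set w | (dispersion_time X w <= r%:E)%E] <=
   (\sum_(s < (Num.truncn r).+1) \sum_x law s x * (#|unhappy x| == 0%N)%:R)%:E)%E.
Proof.
move=> r0; rewrite dispersion_time_le // -sumEFin.
under eq_bigr do rewrite -(prob_pred _ (fun x => #|unhappy x| == 0%N)).
rewrite bigcup_mkord.
have mD s : measurable [set w | #|unhappy (X s w)| == 0%N].
  exact: (measurable_pred s (fun x => #|unhappy x| == 0%N)).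
apply: (content_subadditive P (F := fun s => [set w | #|unhappy (X s w)| == 0%N])) => //.
by apply: bigsetU_measurable => s _.
Qed.

End Law.

Arguments law {V M R d Omega} P X t x.

(** * Unhappy particles along the trajectory *)

Section Dispersion.
Context {R : realType} {n M : nat} {G : rel 'I_n} {o : 'I_n}.
Context {d : measure_display} {Omega : measurableType d}.
Context {P : probability Omega R} {X : nat -> Omega -> config 'I_n M}.
Context (GE : G = complete_graph n \/ G = star_graph n).
Context (procX : dispersion_process G P o X).
Context (n_gt2 : (2 < n)%N) (M_gt1 : (1 < M)%N).

Local Notation unhappy x := (colliding [set: 'I_M]%SET x).
Local Notation S := {ffun 'I_M -> 'I_n}.
Local Notation step x y := (step_prob G x y : R).
Local Notation x0 := ([ffun=> o] : S).

Let inv (x : S) := hub G x \/ relay (R := R) G x.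

Lemma inv_step x y : inv x -> step x y != 0 -> inv y.
Proof.
by case=> [hx|rx]; [exact: hub_step | case/rx => hy _; left].
Qed.

Lemma card_unhappy_const (v : 'I_n) : #|unhappy ([ffun=> v] : S)| = M.
Proof.
rewrite -[RHS]card_ord -cardsT; apply: eq_card => i; rewrite in_setT.
apply/collidingP; split=> //.
have [j] : exists j, j \in [set~ i]%SET.
  by apply/card_gt0P; rewrite cardsC1 card_ord; lia.
by rewrite !inE => ji; exists j; rewrite !ffunE inE.
Qed.

Let ge0 := @step_prob_ge0 'I_n M R G.
Let sum1 := @step_prob_sum1 'I_n M R G (degree_gt0 GE n_gt2).
Let start := law_start procX.
Let stepE := law_step procX.
Let inv_start : inv x0 := hub_or_relay_const GE n_gt2 o.

(* In the star, the unhappy particles alternate between the centre and the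
   leaves, and only the steps from the centre contract their expected number.
   The factor (1 - delta / 2)^-1 makes every step contract. *)
Lemma mean_unhappy_le (delta : R) t : 0 < delta <= 1 ->
  M%:R / n%:R <= 2^-1 * (1 - delta) ->
  \sum_x law P X t x * (#|unhappy x| != 0%N)%:R <=
  (1 - delta / 2) ^+ t * ((1 - delta / 2)^-1 * n%:R).
Proof.
move=> /andP[delta0 delta1] Mn; set lambda := 1 - delta / 2.
have l0 : 0 < lambda by rewrite /lambda; lra.
have lV1 : 1 <= lambda^-1 by rewrite invf_ge1 // /lambda; lra.
have n0 : 0 < n%:R :> R by rewrite ltr0n; lia.
(* A relay step ends in a hub and sheds the surcharge [lambda^-1]. A hub step may incur it, which is
   affordable because its own factor is at most [1 - delta <= lambda ^+ 2]. *)
pose g (x : S) : R := #|unhappy x|%:R * (if hub G x then 1 else lambda^-1).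
have g_ge x : (#|unhappy x| != 0%N)%:R <= g x.
  rewrite /g; have [->|u0] := eqVneq #|unhappy x| 0%N; first by rewrite mul0r.
  by apply: mulr_ege1; [rewrite ler1n lt0n | case: ifP].
have g_le x : g x <= lambda^-1 * #|unhappy x|%:R.
  by rewrite /g mulrC ler_wpM2r //; case: ifP.
apply: (@le_trans _ _ (\sum_x law P X t x * g x)).
  by apply: (le_chain_mean ge0 start stepE inv_start inv_step) => x _; exact: g_ge.
have decay x : inv x -> \sum_y step x y * g y <= lambda * g x.
  have [hx _|hx] := boolP (hub G x); last first.
    case=> [|rx]; first by rewrite (negPf hx).
    rewrite [X in _ <= _ * X]/g (negPf hx) mulrCA divff ?gt_eqF // mulr1.
    have -> : #|unhappy x|%:R = \sum_y step x y * #|unhappy x|%:R :> R.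
      by rewrite -mulr_suml sum1 mul1r.
    apply: ler_sum => y _.
    have [->|/rx[hy cy]] := eqVneq (step x y) 0; first by rewrite !mul0r.
    by rewrite /g hy mulr1 cy.
  rewrite [X in _ <= _ * X]/g hx mulr1.
  apply: (@le_trans _ _ (\sum_y lambda^-1 * (step x y * #|unhappy y|%:R))).
    apply: ler_sum => y _; rewrite [leRHS]mulrCA; apply: ler_wpM2l; first exact: ge0.
    exact: g_le.
  rewrite -mulr_sumr mulrC ler_pdivrMr //.
  apply: le_trans (hub_unhappy_mean (degree_gt0 GE n_gt2) hx) _.
  rewrite [leRHS]mulrAC ler_wpM2r // card_ord mulrA ler_pdivrMr; last first.
    by rewrite ltr0n; lia.
  have -> : M.-1%:R = M%:R - 1 :> R by rewrite -subn1 natrB //; lia.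
  have -> : n.-1%:R = n%:R - 1 :> R by rewrite -subn1 natrB //; lia.
  have n1 : 1 <= n%:R :> R by rewrite ler1n; lia.
  move: Mn; rewrite ler_pdivrMr // /lambda.
  (* The slack in [lambda ^+ 2 = 1 - delta + delta ^+ 2 / 4]. *)
  have : 0 <= delta ^+ 2 / 4 * (n%:R - 1).
    by rewrite mulr_ge0 ?divr_ge0 ?sqr_ge0 // subr_ge0.
  by move=> ? ?; nra.
apply: le_trans (chain_decay ge0 start stepE inv_start inv_step t (ltW l0) decay) _.
rewrite ler_wpM2l ?exprn_ge0 ?(ltW l0) //; apply: le_trans (g_le _) _.
rewrite card_unhappy_const ler_wpM2l ?(le_trans ler01) // ler_nat.
rewrite -(ler_nat R); move: Mn; rewrite ler_pdivrMr // => Mn; nra.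
Qed.

(** [chain_escape] with [bad] meaning fewer than [m] unhappy particles: a relay step preserves the
    count, and a hub step falls below [m] only with the probability bounded in [hub_few_unhappy]. *)
Lemma few_unhappy_prob (m s : nat) (p z : R) : (0 < m <= M)%N ->
  0 < z <= 1 -> 0 <= p <= 1 -> p * n.-1%:R <= (M - 2 * m).-1%:R ->
  \sum_x law P X s x * (#|unhappy x| == 0%N)%:R <=
  s%:R * ((1 - p * (1 - z ^+ 2)) / z) ^+ m.
Proof.
move=> /andP[m0 mM] z01 p01 pM.
have rate_ge0 : 0 <= ((1 - p * (1 - z ^+ 2)) / z) ^+ m.
  have [/andP[z0 z1] /andP[p0 p1]] := (z01, p01).
  rewrite exprn_ge0 // divr_ge0 ?(ltW z0) // subr_ge0 mulr_ile1 //.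
    by rewrite subr_ge0 expr_le1 // ltW.
  by rewrite gerBl exprn_ge0 // ltW.
apply: (@le_trans _ _ (\sum_x law P X s x * (#|unhappy x| < m)%:R)).
  apply: (le_chain_mean ge0 start stepE inv_start inv_step) => x _.
  by rewrite ler_nat; case: eqP => [->|//]; rewrite m0.
apply: (chain_escape ge0 sum1 start stepE inv_start inv_step).
- exact: rate_ge0.
- by rewrite card_unhappy_const -leqNgt.
move=> x ix; rewrite -leqNgt => mx; have [hx|hx] := boolP (hub G x).
  apply: hub_few_unhappy => //; first exact: degree_gt0.
  by rewrite card_ord.
case: ix hx => [->//|rx _]; rewrite big1 => [|y _].
  exact: rate_ge0.
have [->|/rx[_ cy]] := eqVneq (step x y) 0; first by rewrite mul0r.
by rewrite cy ltnNge mx mulr0.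
Qed.

(** All particles may jump to the same neighbour of [o], with probability at least [n ^- M], and
    then all are still unhappy. This serves for bounded [n]. *)
Lemma first_step_prob : (M <= n)%N ->
  \sum_x law P X 1 x * (#|unhappy x| == 0%N)%:R <= 1 - n%:R^-1 ^+ n.
Proof.
move=> Mn; have /card_gt0P[v ov] := degree_gt0 GE n_gt2 o.
pose y : S := [ffun=> v].
have uy : #|unhappy y| == 0%N = false by rewrite card_unhappy_const; lia.
have ux0 i : i \in unhappy x0.
  rewrite (_ : unhappy x0 = [set: 'I_M]%SET) ?inE //; apply/eqP.
  by rewrite eqEcard subsetT cardsT card_ord card_unhappy_const leqnn.
have other : \sum_(x | x != y) law P X 1 x * (#|unhappy x| == 0%N)%:R <=
    \sum_(x | x != y) law P X 1 x.
  apply: ler_sum => x _; rewrite ler_piMr ?(chain_ge0 ge0 start stepE) //.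
  by rewrite lern1 leq_b1.
have := chain_sum1 sum1 start stepE 1.
rewrite (bigD1 y) //= (bigD1 y (F := fun x => law P X 1 x * _)) //= uy mulr0 add0r.
move=> total; rewrite lerBrDl -[leRHS]total; apply: lerD other.
rewrite stepE (chain_mean0 start (fun x => step x y)).
apply: (@le_trans _ _ (n%:R^-1 ^+ M)).
  apply: ler_wiXn2l => //.
  by rewrite invf_le1 ?ler1n ?ltr0n; lia.
rewrite -[X in _ ^+ X]card_ord -prodr_const; apply: ler_prod => i _.
rewrite invr_ge0 ler0n /= move_prob_unhappy // !ffunE.
rewrite (_ : G o v = true) // lef_pV2 ?posrE ?ltr0n ?(degree_gt0 GE n_gt2) //;
  last by lia.
by rewrite ler_nat -[leqRHS]card_ord max_card.
Qed.

End Dispersion.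

(** * Explicit bounds below and above the critical density *)

Lemma expR_half_le2 (R : realType) (x : R) : x <= 1 / 2 -> expR x <= 2.
Proof.
move=> x2; rewrite -(@lef_pV2 R) ?posrE ?expR_gt0 // -expRN.
by apply: le_trans (expR_ge1Dx _); lra.
Qed.

Section Bounds.
Context {R : realType} {n M : nat} {G : rel 'I_n} {o : 'I_n}.
Context {d : measure_display} {Omega : measurableType d}.
Context {P : probability Omega R} {X : nat -> Omega -> config 'I_n M}.
Context (GE : G = complete_graph n \/ G = star_graph n).
Context (procX : dispersion_process G P o X).

Lemma dispersion_fast (delta : R) : 0 < delta <= 1 / 2 ->
  M%:R / n%:R <= 2^-1 * (1 - delta) ->
  ((1 - 4 / n%:R)%:E
     <= P [set w | (dispersion_time X w <= (4 / delta * ln n%:R)%:E)%E])%E.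
Proof.
move=> /andP[delta0 delta2] Mn.
have n_gt0 : (0 < n)%N by case: n o => [[]|].
have n0 : 0 < n%:R :> R by rewrite ltr0n.
have r0 : 0 <= 4 / delta * ln n%:R.
  by rewrite mulr_ge0 ?divr_ge0 ?(ltW delta0) // ln_ge0 // ler1n.
apply: le_trans (prob_dispersed_late procX r0); rewrite lee_fin lerD2l lerN2.
set t := Num.truncn _.
have [M_le1|M_gt1] := leqP M 1.
  rewrite big1 ?divr_ge0 ?ler0n // => x _.
  have /dispersedP -> : dispersed x.
    move=> v; apply: leq_trans M_le1; rewrite -[leqRHS]card_ord; exact: max_card.
  by rewrite cards0 mulr0.
have n_gt2 : (2 < n)%N.
  rewrite -(ltr_nat R); move: Mn; rewrite ler_pdivrMr //.
  have : 2 <= M%:R :> R by rewrite (ler_nat R 2).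
  by nra.
apply: le_trans (mean_unhappy_le GE procX n_gt2 M_gt1 t _ Mn) _.
  by rewrite delta0 /=; lra.
have lambda_ge : 2^-1 <= 1 - delta / 2 by lra.
have lambda_gt0 : 0 < 1 - delta / 2 by lra.
have lV : (1 - delta / 2)^-1 <= 2.
  by rewrite -[leRHS]invrK lef_pV2 ?posrE ?invr_gt0.
(* From [t + 1 > 4 / delta * ln n] the exponent is at most [delta / 2 - 2 * ln n]; the factor 2 pays
   for the truncation. *)
have lt : (1 - delta / 2) ^+ t <= 2 * n%:R^-1 ^+ 2.
  apply: (@le_trans _ _ (expR (- (delta / 2)) ^+ t)).
    apply: lerXn2r; rewrite ?nnegrE ?expR_ge0 //; first by lra.
    exact: expR_ge1Dx.
  rewrite -expRM_natl.
  apply: (@le_trans _ _ (expR (delta / 2 + - (2 * ln n%:R)))).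
    rewrite ler_expR.
    have : 4 / delta * ln n%:R < t.+1%:R := truncnS_gt _.
    rewrite mulrAC ltr_pdivrMr // -natr1; lra.
  rewrite expRD expRN expRM_natl lnK ?posrE // exprVn.
  rewrite ler_wpM2r ?invr_ge0 ?exprn_ge0 ?(ltW n0) //.
  by apply: expR_half_le2; lra.
apply: (@le_trans _ _ ((2 * n%:R^-1 ^+ 2) * (2 * n%:R))).
  apply: ler_pM => //.
  - by rewrite exprn_ge0 // ltW.
  - by rewrite mulr_ge0 ?ler0n // invr_ge0 ltW.
  - by rewrite ler_wpM2r // ler0n.
by rewrite le_eqVlt; apply/orP; left; apply/eqP; field; rewrite gt_eqF.
Qed.

Context (M_gt1 : (1 < M)%N) (n_gt2 : (2 < n)%N).

(** Here [expR (c * n) < 2], so only times 0 and 1 matter. Time 0 is impossible, and time 1 has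
    probability at most [1 - n ^- n < 1 - c * n <= expR (- (c * n))]. *)
Lemma dispersion_slow_small (c : R) : (M < n)%N -> 0 < c * n%:R < 1 / 2 ->
  c * n%:R < n%:R^-1 ^+ n ->
  (P [set w | (dispersion_time X w <= (expR (c * n%:R))%:E)%E]
     < (expR (- (c * n%:R)))%:E)%E.
Proof.
move=> Mn /andP[cn0 cn2] cn.
apply: le_lt_trans (prob_dispersed_early procX (expR_ge0 _)) _.
have -> : Num.truncn (expR (c * n%:R)) = 1%N.
  apply: truncn_def; apply/andP; split.
    by apply: le_trans (expR_ge1Dx _); lra.
  rewrite -(@ltf_pV2 R) ?posrE ?expR_gt0 // -expRN.
  by apply: lt_le_trans (expR_ge1Dx _); lra.
rewrite lte_fin big_ord_recl big_ord1 /=.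
rewrite (chain_mean0 (law_start procX) (fun x => (#|colliding _ x| == 0%N)%:R)).
rewrite card_unhappy_const // gtn_eqF ?(ltnW M_gt1) // add0r.
apply: le_lt_trans (first_step_prob GE procX n_gt2 M_gt1 (ltnW Mn)) _.
by apply: lt_le_trans (expR_ge1Dx _); lra.
Qed.

Lemma dispersion_slow_large (delta c : R) : 0 < delta <= 1 ->
  24 / delta <= n%:R -> 2^-1 * (1 + delta) <= M%:R / n%:R ->
  0 < c -> 4 * c <= (delta / 4) ^+ 2 / 2 * (delta / 16) ->
  (P [set w | (dispersion_time X w <= (expR (c * n%:R))%:E)%E]
     < (expR (- (c * n%:R)))%:E)%E.
Proof.
move=> /andP[delta0 delta1]; rewrite ler_pdivrMr // => ndelta.
have n0 : 0 < n%:R :> R by rewrite ltr0n; lia.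
rewrite ler_pdivlMr // => Mdelta c0 c_le.
set eta := delta / 4; set m := (Num.truncn (delta / 16 * n%:R)).+1.
have eps0 : 0 <= delta / 16 * n%:R by rewrite mulr_ge0 ?ler0n //; lra.
have m_gt : delta / 16 * n%:R < m%:R := truncnS_gt _.
have m_le : m%:R <= delta / 16 * n%:R + 1.
  by rewrite /m -natr1 lerD2r truncn_le.
pose p := 1 / 2 + eta; pose z := 1 - eta.
have mM : (0 < m <= M)%N.
  by rewrite /= -(ler_nat R); apply: le_trans m_le _; nra.
have z01 : 0 < z <= 1 by rewrite /z /eta; apply/andP; split; lra.
have p01 : 0 <= p <= 1 by rewrite /p /eta; apply/andP; split; lra.
have subn_ge (a b : nat) : a%:R - b%:R <= (a - b)%:R :> R.
  have [ba|/ltnW ab] := leqP b a; first by rewrite natrB.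
  by rewrite (eqP (_ : (a - b == 0)%N)) ?subn_eq0 // subr_le0 ler_nat.
(* [M - 2 * m - 1] is at least [(1 / 2 + 3 * delta / 8) * n - 3], and [24 / delta <= n] absorbs the
   3 into [delta * n / 8]. *)
have pM : p * n.-1%:R <= (M - 2 * m).-1%:R.
  have h1 : n.-1%:R <= n%:R :> R by rewrite ler_nat leq_pred.
  have h2 : M%:R - 2 * m%:R - 1 <= (M - 2 * m).-1%:R :> R.
    rewrite -subn1; apply: le_trans (subn_ge _ _); rewrite lerD2r.
    by rewrite -natrM.
  apply: le_trans h2; apply: (@le_trans _ _ (p * n%:R)).
    by rewrite ler_wpM2l //; case/andP: p01.
  rewrite /p /eta; lra.
set rho := (1 - p * (1 - z ^+ 2)) / z.
have rho_le : 0 <= rho <= expR (- (eta ^+ 2 / 2)).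
  have z0 : 0 < z by case/andP: z01.
  have e0 : 0 <= eta by rewrite /eta; lra.
  have e1 : eta <= 1 / 4 by rewrite /eta; lra.
  apply/andP; split.
    by rewrite divr_ge0 ?(ltW z0) // /p /z; nra.
  apply: le_trans (expR_ge1Dx _); rewrite ler_pdivrMr // /p /z.
  (* This is exactly [(1 - eta ^+ 2 / 2) * z] minus the numerator of [rho]. *)
  have : 0 <= eta ^+ 2 * (1 - eta / 2) by rewrite mulr_ge0 ?sqr_ge0 //; lra.
  by move: (eta) => e; nra.
set r := rho ^+ m.
have r0 : 0 <= r by rewrite exprn_ge0 //; case/andP: rho_le.
have r_le : r <= expR (- (4 * (c * n%:R))).
  apply: (@le_trans _ _ (expR (- (eta ^+ 2 / 2)) ^+ m)).
    by case/andP: rho_le => ? ?; apply: lerXn2r; rewrite ?nnegrE ?expR_ge0.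
  rewrite -expRM_natl ler_expR mulrN lerN2 mulrA.
  apply: (@le_trans _ _ (eta ^+ 2 / 2 * (delta / 16) * n%:R)).
    by rewrite ler_wpM2r // ltW.
  rewrite -mulrA mulrC ler_wpM2r ?(ltW m_gt) //.
  by rewrite divr_ge0 ?sqr_ge0.
apply: le_lt_trans (prob_dispersed_early procX (expR_ge0 _)) _.
rewrite lte_fin; set t := Num.truncn _.
have t_le : t%:R <= expR (c * n%:R) by rewrite truncn_le expR_ge0.
have bound s := few_unhappy_prob GE procX n_gt2 M_gt1 s mM z01 p01 pM.
(* The term of time 0 vanishes and the other [t] terms are at most [t * r]. Both factors [t] cost
   [expR (c * n)], so the rate [4 * c] in [r] leaves [expR (- (2 * (c * n)))]. *)
apply: (@le_lt_trans _ _ (t%:R * (t%:R * r))).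
  rewrite big_ord_recl -[leRHS]add0r; apply: lerD.
    by apply: le_trans (bound _) _; rewrite mul0r.
  rewrite mulr_natl -[X in _ *+ X]card_ord -sumr_const; apply: ler_sum => i _.
  apply: le_trans (bound _) _; rewrite ler_wpM2r // ler_nat.
  exact: ltn_ord i.
apply: (@le_lt_trans _ _ (expR (- (2 * (c * n%:R))))).
  rewrite (_ : - _ = c * n%:R + (c * n%:R + - (4 * (c * n%:R)))); last by ring.
  by rewrite !expRD !ler_pM ?mulr_ge0.
by rewrite ltr_expR ltrN2 ltr_pMl ?ltr1n // mulr_gt0.
Qed.

End Bounds.

Theorem theorem1 (R : realType) (delta : R) (delta_gt0 : 0 < delta) :
  (exists C C' : R, [/\ 0 < C, 0 < C' &
     forall (n M : nat) (G : rel 'I_n) (o : 'I_n)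
       (d : measure_display) (Omega : measurableType d)
       (P : probability Omega R) (X : nat -> Omega -> config 'I_n M),
       G = complete_graph n \/ G = star_graph n ->
       dispersion_process G P o X ->
       M%:R / n%:R <= 2^-1 * (1 - delta) ->
       ((1 - C' / n%:R)%:E
          <= P [set w | (dispersion_time X w <= (C * ln n%:R)%:E)%E])%E])
  /\
  (exists c : R, 0 < c /\
     forall (n M : nat) (G : rel 'I_n) (o : 'I_n)
       (d : measure_display) (Omega : measurableType d)
       (P : probability Omega R) (X : nat -> Omega -> config 'I_n M),
       G = complete_graph n \/ G = star_graph n ->
       dispersion_process G P o X ->
       2^-1 * (1 + delta) <= M%:R / n%:R ->
       M%:R / n%:R < 1 :> R ->
       (P [set w | (dispersion_time X w <= (expR (c * n%:R))%:E)%E]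
          < (expR (- (c * n%:R)))%:E)%E).
Proof.
split.
  (* The assumptions on [M / n] weaken as [delta] decreases, so [delta] may be capped. *)
  pose delta' := Num.min delta (1 / 2).
  have d'0 : 0 < delta' by rewrite lt_min delta_gt0; lra.
  exists (4 / delta'), 4; split=> [||n M G o d Omega P X GE procX Mn] //.
    by rewrite divr_gt0.
  apply: (dispersion_fast GE procX); first by rewrite d'0 ge_min lexx orbT.
  apply: le_trans Mn _; rewrite ler_wpM2l ?invr_ge0 // lerD2l lerN2.
  by rewrite ge_min lexx.
pose delta' := Num.min delta 1.
have d'0 : 0 < delta' by rewrite lt_min delta_gt0 ltr01.
(* Beyond [N] the exponential estimate applies; up to [N] the first step decides. *)
pose N := (Num.truncn (24 / delta')).+1.
have N0 : 0 < N%:R :> R by rewrite ltr0n.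
have NV1 : N%:R^-1 <= 1 :> R by rewrite invf_le1 // ler1n.
pose a : R := N%:R^-1 ^+ N.
have a0 : 0 < a by rewrite exprn_gt0 // invr_gt0.
have a1 : a <= 1 by rewrite exprn_ile1 // invr_ge0 ltW.
(* [c1] gives [c * n <= a / 3], below both [1 / 2] and [n ^- n] for [n <= N]; [c2] is a quarter of
   the decay rate for large [n]. *)
pose c1 := a / (3 * N%:R); pose c2 := (delta' / 4) ^+ 2 / 2 * (delta' / 16) / 4.
have c1_gt0 : 0 < c1 by rewrite divr_gt0 // mulr_gt0.
have c2_gt0 : 0 < c2 by rewrite divr_gt0 // mulr_gt0 ?divr_gt0 ?exprn_gt0 ?divr_gt0.
exists (Num.min c1 c2); split; first by rewrite lt_min c1_gt0.
set c := Num.min c1 c2; have c0 : 0 < c by rewrite lt_min c1_gt0.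
move=> n M G o d Omega P X GE procX Mdelta Mn1.
have n_gt0 : (0 < n)%N by case: n o {G P X GE procX Mdelta Mn1} => [[]|].
have n0 : 0 < n%:R :> R by rewrite ltr0n.
have Mn : (M < n)%N by move: Mn1; rewrite ltr_pdivrMr // mul1r ltr_nat.
have Mdelta' : 2^-1 * (1 + delta') <= M%:R / n%:R.
  apply: le_trans Mdelta; rewrite ler_wpM2l ?invr_ge0 // lerD2l.
  by rewrite ge_min lexx.
have n2M : (n < 2 * M)%N.
  rewrite -(ltr_nat R) natrM; move: Mdelta'; rewrite ler_pdivlMr //.
  by have := mulr_gt0 d'0 n0; lra.
have M_gt1 : (1 < M)%N by move: n2M Mn; clear; lia.
have n_gt2 : (2 < n)%N by move: n2M Mn; clear; lia.
have [nN|Nn] := leqP n N.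
  have cn : c * n%:R <= a / 3.
    apply: (@le_trans _ _ (c1 * N%:R)); last first.
      by rewrite /c1 invfM mulrA mulfVK ?gt_eqF.
    apply: ler_pM; rewrite ?ler0n ?(ltW c0) ?ler_nat //.
    by rewrite /c ge_min lexx.
  apply: (dispersion_slow_small GE procX) => //.
    by rewrite mulr_gt0 //=; lra.
  apply: (@lt_le_trans _ _ a); first by lra.
  apply: (@le_trans _ _ (N%:R^-1 ^+ n)).
    by apply: ler_wiXn2l => //; rewrite invr_ge0 ltW.
  by apply: lerXn2r; rewrite ?nnegrE ?invr_ge0 ?ler0n // lef_pV2 ?posrE // ler_nat.
have d'01 : 0 < delta' <= 1 by rewrite d'0 ge_min lexx orbT.
apply: (dispersion_slow_large GE procX M_gt1 n_gt2 d'01) => //.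
- by apply: ltW; apply: lt_trans (truncnS_gt _) _; rewrite ltr_nat.
- have : c <= c2 by rewrite /c ge_min lexx orbT.
  by rewrite /c2; lra.
Qed.
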